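(* Let $R$ be a non-commutative ring of finite order $n$ with $Z(R)=\{0\}$. Then: (i) $\gamma(\Gamma(R))+\gamma(\overline{\Gamma}(R))=n$ if and only if $R$ is isomorphic to one of the following two rings: $E=\langle x,y : 2x=2y=0,\ x^2=x,\ y^2=y,\ xy=x,\ yx=y\rangle$, $F=\langle x,y : 2x=2y=0,\ x^2=x,\ y^2=y,\ xy=y,\ yx=x\rangle$. (ii) $\gamma(\Gamma(R))+\gamma(\overline{\Gamma}(R))\neq n-1$. (iii) $\gamma(\Gamma(R))+\gamma(\overline{\Gamma}(R))=n-2$ if and only if $n$ is even and $\Gamma(R)$ is isomorphic to $K_3\cup (n-4)K_1$, the disjoint union of a complete graph on $3$ vertices and $n-4$ isolated vertices.
   Context: Rings are associative and are not required to have a multiplicative identity. $Z(R)$ is the center of $R$. For a non-commutative ring $R$, the commuting graph $\Gamma(R)$ is the simple graph with vertex set $R\setminus Z(R)$ in which two vertices $x,y$ are adjacent if and only if $x\neq y$ and $xy=yx$; $\overline{\Gamma}(R)$ is its complement graph (same vertex set). A dominating set of a graph $G$ is a subset $D\subseteq V(G)$ such that every vertex not in $D$ is adjacent to at least one vertex of $D$; the domination number $\gamma(G)$ is the minimum cardinality of a dominating set. The rings $E$ and $F$ are rings of order $4$ without identity, given by generators and relations: the additive group is $\mathbb{Z}_2x\oplus\mathbb{Z}_2y$ and the multiplication is determined by the listed products. *)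

(* Defs.v *)
From HB Require Import structures.
From mathcomp Require Import all_boot all_algebra ring.

Set Implicit Arguments.
Unset Strict Implicit.
Unset Printing Implicit Defensive.

Import GRing.Theory.

Local Open Scope ring_scope.

(* Every ring structure of MathComp has a multiplicative identity, hence a
   separate structure for associative rings, with or without identity. *)
HB.mixin Record isRng R of GRing.Zmodule R := {
  rmul : R -> R -> R;
  rmulA : associative rmul;
  rmulDl : left_distributive rmul +%R;
  rmulDr : right_distributive rmul +%R
}.

#[short(type="finRngType")]
HB.structure Definition FinRng := {R of isRng R & FinRing.Zmodule R}.

Declare Scope rng_scope.
Delimit Scope rng_scope with rng.
Notation "x * y" := (rmul x y) : rng_scope.

Definition rng_center (R : finRngType) : {set R} :=
  [set x | [forall y, (x * y)%rng == (y * x)%rng]].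

Definition rng_isomorphic (R S : finRngType) : Prop :=
  exists f : R -> S,
    [/\ bijective f,
        {morph f : x y / x + y} &
        {morph f : x y / (x * y)%rng}].

(* Z_2 x (+) Z_2 y is encoded as 'rV['F_2]_2, with x and y its canonical
   basis. *)
Definition genx : 'rV['F_2]_2 := delta_mx 0 0.
Definition geny : 'rV['F_2]_2 := delta_mx 0 1.

(* The biadditive product on Z_2 x (+) Z_2 y determined by the values
   xx, xy, yx, yy of x^2, x y, y x, y^2. *)
Definition table_mul (xx xy yx yy u v : 'rV['F_2]_2) : 'rV['F_2]_2 :=
  (u 0 0 * v 0 0) *: xx + (u 0 0 * v 0 1) *: xy +
  (u 0 1 * v 0 0) *: yx + (u 0 1 * v 0 1) *: yy.

Lemma table_mulDl xx xy yx yy :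
  left_distributive (table_mul xx xy yx yy) +%R.
Proof. by move=> u v w; apply/rowP => i; rewrite !mxE; ring. Qed.

Lemma table_mulDr xx xy yx yy :
  right_distributive (table_mul xx xy yx yy) +%R.
Proof. by move=> u v w; apply/rowP => i; rewrite !mxE; ring. Qed.

Definition mulE : 'rV['F_2]_2 -> 'rV['F_2]_2 -> 'rV['F_2]_2 :=
  table_mul genx genx geny geny.

Definition mulF : 'rV['F_2]_2 -> 'rV['F_2]_2 -> 'rV['F_2]_2 :=
  table_mul genx geny genx geny.

Lemma mulEA : associative mulE.
Proof. by move=> u v w; apply/rowP => i; rewrite !mxE /=; ring. Qed.

Lemma mulFA : associative mulF.
Proof. by move=> u v w; apply/rowP => i; rewrite !mxE /=; ring. Qed.

Definition ringE : Type := 'rV['F_2]_2.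
HB.instance Definition _ := FinRing.Zmodule.on ringE.
HB.instance Definition _ :=
  isRng.Build ringE mulEA (table_mulDl _ _ _ _) (table_mulDr _ _ _ _).

Definition ringF : Type := 'rV['F_2]_2.
HB.instance Definition _ := FinRing.Zmodule.on ringF.
HB.instance Definition _ :=
  isRng.Build ringF mulFA (table_mulDl _ _ _ _) (table_mulDr _ _ _ _).

Record sgraph := SGraph {
  vertex :> finType;
  adj : rel vertex;
  adj_sym : symmetric adj;
  adj_irrefl : irreflexive adj
}.

Definition graph_isomorphic (G H : sgraph) : Prop :=
  exists f : G -> H, bijective f /\ {mono f : x y / adj x y}.

Section Complement.
Variable G : sgraph.

Definition compl_adj : rel G := [rel x y | (x != y) && ~~ adj x y].

Fact compl_adj_sym : symmetric compl_adj.
Proof. by move=> x y; rewrite /compl_adj /= eq_sym adj_sym. Qed.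

Fact compl_adj_irrefl : irreflexive compl_adj.
Proof. by move=> x; rewrite /compl_adj /= eqxx. Qed.

Definition complement : sgraph := SGraph compl_adj_sym compl_adj_irrefl.

End Complement.

Section Complete.
Variable m : nat.

Definition complete_adj : rel 'I_m := [rel i j | i != j].

Fact complete_adj_sym : symmetric complete_adj.
Proof. by move=> i j; rewrite /complete_adj /= eq_sym. Qed.

Fact complete_adj_irrefl : irreflexive complete_adj.
Proof. by move=> i; rewrite /complete_adj /= eqxx. Qed.

Definition complete_graph : sgraph := SGraph complete_adj_sym complete_adj_irrefl.

End Complete.

Section DisjointUnion.
Variables G H : sgraph.

Definition dunion_adj : rel (G + H)%type := fun u v =>
  match u, v with
  | inl x, inl y => adj x y
  | inr x, inr y => adj x y
  | _, _ => false
  end.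

Fact dunion_adj_sym : symmetric dunion_adj.
Proof. by move=> [x|x] [y|y] //=; rewrite adj_sym. Qed.

Fact dunion_adj_irrefl : irreflexive dunion_adj.
Proof. by move=> [x|x] /=; rewrite adj_irrefl. Qed.

Definition disjoint_union : sgraph := SGraph dunion_adj_sym dunion_adj_irrefl.

End DisjointUnion.

(* m G: the disjoint union of m copies of G. *)
Section Copies.
Variables (m : nat) (G : sgraph).

Definition copies_adj : rel ('I_m * G)%type :=
  [rel u v | (u.1 == v.1) && adj u.2 v.2].

Fact copies_adj_sym : symmetric copies_adj.
Proof. by move=> u v; rewrite /copies_adj /= eq_sym adj_sym. Qed.

Fact copies_adj_irrefl : irreflexive copies_adj.
Proof. by move=> u; rewrite /copies_adj /= adj_irrefl andbF. Qed.

Definition copies : sgraph := SGraph copies_adj_sym copies_adj_irrefl.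

End Copies.

Definition dominating (G : sgraph) (D : {set G}) : bool :=
  [forall x, (x \notin D) ==> [exists y in D, adj x y]].

(* The default [set: G] is a dominating set, so this is a true minimum. *)
Definition domination_number (G : sgraph) : nat :=
  #|[arg min_(D < [set: G] | dominating D) #|D|]|.

Section CommutingGraph.
Variable R : finRngType.

Definition noncentral : finType := {x : R | x \notin rng_center R}.

Definition comm_adj : rel noncentral :=
  [rel x y | (x != y) && ((val x * val y)%rng == (val y * val x)%rng)].

Fact comm_adj_sym : symmetric comm_adj.
Proof.
by move=> x y; rewrite /comm_adj /= [x == y]eq_sym [(val x * _)%rng == _]eq_sym.
Qed.

Fact comm_adj_irrefl : irreflexive comm_adj.
Proof. by move=> x; rewrite /comm_adj /= eqxx. Qed.

Definition commuting_graph : sgraph := SGraph comm_adj_sym comm_adj_irrefl.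

End CommutingGraph.

(* Main.v *)
Require Import Defs.
From mathcomp Require Import all_boot all_algebra fingroup cyclic zify.

Set Implicit Arguments.
Unset Strict Implicit.
Unset Printing Implicit Defensive.

Import GRing.Theory.

Local Open Scope ring_scope.

(** Write C(a) for the centraliser of a, n for the order of R, and gamma,
    gammac for the two domination numbers. The graph has n - 1 vertices, the
    neighbours of a in it are the elements of C(a) other than 0 and a, and C(a)
    is an additive subgroup; Lagrange's theorem in this group drives the proof,
    which distinguishes three cases.

    No edge. Every C(a) is {0, a}, gamma = n - 1 and gammac = 1, so the sum is
    n. Such a ring has characteristic 2, and is not Boolean since Boolean rings
    commute, so some x <> 0 has x^2 = 0. Then x y x = 0 for all y, hence x y and
    y x lie in {0, x}, and the commutator with x takes the two values 0 and x.
    Two elements that do not commute with x therefore differ by an element of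
    C(x) = {0, x}: R has order 4, and its table is that of E or of F
    ([edgeless_structure], [isolated_isomorphic_EF]).

    An edge and an isolated vertex c. Again gammac = 1. As C(c) = {0, c} is a
    subgroup, 2 c = 0 and n is even. For a <> 0 the order of C(a) is even: otherwise some
    odd multiple of c + a equals c, so that c commutes with c + a. Hence a
    vertex a that is not isolated has |C(a)| >= 4, and the complement of
    C(a) minus {0, a} is dominating, which gives gamma <= n - 3 and a sum of at
    most n - 2. If the sum is n - 2, all these centralisers have order 4,
    commuting elements have the same centraliser by Lagrange, so the edges form
    disjoint triangles; a second triangle would lower gamma once more
    ([extremal_clique]).

    No isolated vertex. Here the sum is at most n - 3
    ([no_isolated_bound]): gamma is at most half the number of vertices by Ore's
    argument, and gammac is small because a set D with C(D) = 0 dominates the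
    complement graph. Either two non-commuting elements already form such a D
    and n >= 9, or some z <> 0 commutes with both of them, which forces
    |C(z)| >= 5 and n >= 10, and then a D with 2^|D| <= n does the job.

    So the sum is n exactly without edges and never n - 1. Conversely a
    dominating set of K_3 with n - 4 isolated vertices has at least n - 3
    elements, so that the bound n - 2 is attained there. *)

(** * Finite abelian groups *)

Section AdditiveSubsets.
Variable U : finZmodType.
Implicit Types A B : {set U}.

Definition add_closed A := 0 \in A /\ {in A &, forall x y, x + y \in A}.

Lemma add_closed_group_set A : add_closed A -> group_set (A : {set U}).
Proof. by case=> A0 AD; apply/group_setP; split. Qed.

Lemma add_closed_dvdn A B :
  add_closed A -> add_closed B -> A \subset B -> (#|A| %| #|B|)%N.
Proof.
move=> /add_closed_group_set gA /add_closed_group_set gB sAB.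
exact: (@cardSg _ (Group gB) (Group gA)).
Qed.

Lemma add_closed_mulrn A x : add_closed A -> x \in A -> x *+ #|A| = 0.
Proof.
move=> /add_closed_group_set gA Ax.
exact: (@expg_cardG _ (Group gA) x Ax).
Qed.

Lemma add_closedN A x : add_closed A -> x \in A -> - x \in A.
Proof.
move=> /add_closed_group_set gA Ax.
exact: (@groupVr _ (Group gA) x Ax).
Qed.

Lemma add_closedI A B : add_closed A -> add_closed B -> add_closed (A :&: B).
Proof.
case=> A0 AD [B0 BD]; split; first by rewrite inE A0.
by move=> x y /setIP[Ax Bx] /setIP[Ay By]; rewrite inE AD ?BD.
Qed.

Lemma add_closed_proper A B :
  add_closed A -> add_closed B -> A \proper B -> (2 * #|A| <= #|B|)%N.
Proof.
move=> cA cB pAB.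
have /dvdnP[[|[|q]] e] := add_closed_dvdn cA cB (proper_sub pAB).
- by have := proper_card pAB; rewrite e.
- by have := proper_card pAB; rewrite e mul1n ltnn.
by rewrite e leq_mul2r orbT.
Qed.

(** The sum map on A x B is injective when A and B meet only in 0. *)
Lemma add_closed_trivI A B : add_closed A -> add_closed B ->
  A :&: B = [set 0] -> (#|A| * #|B| <= #|U|)%N.
Proof.
move=> cA cB AB0; rewrite -cardsX -(@card_in_imset _ _ (fun p => p.1 + p.2)).
  exact: max_card.
move=> [a b] [a' b'] /setXP[/= Aa Bb] /setXP[/= Aa' Bb'] e.
have e' : a - a' = b' - b.
  by apply: (addIr (a' + b)); rewrite addrA subrK e addrCA subrK.
have : a - a' \in A :&: B.
  apply/setIP; split; first by apply: (proj2 cA); rewrite ?add_closedN.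
  by rewrite e'; apply: (proj2 cB); rewrite ?add_closedN.
rewrite AB0 inE subr_eq0 => /eqP aa'; move: e'; rewrite aa' subrr.
by move/esym/eqP; rewrite subr_eq0 => /eqP ->.
Qed.

End AdditiveSubsets.

(** * Domination in graphs *)

Section Domination.
Variable G : sgraph.
Implicit Types (D S : {set G}) (x y : G).

Lemma dominatingP D :
  reflect (forall x, x \notin D -> exists2 y, y \in D & adj x y) (dominating D).
Proof.
apply: (iffP forallP) => domD x.
  by move=> xD; have /implyP/(_ xD)/exists_inP := domD x.
by apply/implyP => xD; apply/exists_inP; apply: domD.
Qed.

Lemma dominatingT : @dominating G [set: G].
Proof. by apply/dominatingP => x; rewrite inE. Qed.

Lemma domination_number_le D : dominating D -> (domination_number G <= #|D|)%N.
Proof.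
by rewrite /domination_number; case: arg_minnP => [|A _ minA /minA //]; exact: dominatingT.
Qed.

Lemma domination_number_ex : exists2 D : {set G}, dominating D & domination_number G = #|D|.
Proof.
rewrite /domination_number; case: arg_minnP => [|A domA _]; first exact: dominatingT.
by exists A.
Qed.

Lemma dominating_setC S :
  (forall x, x \in S -> exists2 y, y \notin S & adj x y) -> dominating (~: S).
Proof.
move=> outS; apply/dominatingP => x; rewrite inE negbK => /outS[y yS xy].
by exists y; rewrite ?inE.
Qed.

Lemma domination_number_sub S :
  (forall x, x \in S -> exists2 y, y \notin S & adj x y) ->
  (domination_number G + #|S| <= #|G|)%N.
Proof.
move=> /dominating_setC/domination_number_le; rewrite -(cardsC S) addnC.
by rewrite leq_add2l.
Qed.

(** Ore's argument: the complement of a smallest dominating set D is dominating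
    too. A vertex x of D with no neighbour outside D has one inside, which
    dominates x, and no vertex outside D needs x, so x could be removed. *)
Lemma domination_number_half :
  (forall x, exists y, adj x y) -> (2 * domination_number G <= #|G|)%N.
Proof.
move=> nbr; have [D domD gD] := domination_number_ex.
rewrite mul2n -addnn {2}gD; apply: domination_number_sub => x xD.
apply/exists_inP; apply: contraT; rewrite negb_exists_in => /forall_inP xC.
have inD y : adj x y -> y \in D.
  by move=> xy; apply: contraT => /xC; rewrite xy.
suff /domination_number_le : dominating (D :\ x).
  by rewrite gD (cardsD1 x D) xD add1n ltnn.
apply/dominatingP => z; rewrite !inE negb_and negbK.
have [-> _|zx /= zD] := eqVneq z x.
  have [y xy] := nbr x; exists y => //; rewrite !inE inD // andbT.
  by apply: contraTneq xy => ->; rewrite adj_irrefl.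
have [y yD zy] := dominatingP _ domD z zD.
exists y => //; rewrite !inE yD andbT; apply: contraNneq zD => yx.
by apply: inD; rewrite adj_sym -yx.
Qed.

Lemma domination_number_gt0 x : (0 < domination_number G)%N.
Proof.
have [D /dominatingP domD ->] := domination_number_ex; rewrite card_gt0.
apply: contraT; rewrite negbK => /eqP D0.
by have [|y] := domD x; rewrite D0 inE.
Qed.

Lemma domination_number_edgeless :
  (forall x y, ~~ adj x y) -> domination_number G = #|G|.
Proof.
move=> noedge; have [D /dominatingP domD ->] := domination_number_ex.
rewrite -cardsT; congr #|pred_of_set _|; apply/setP => x; rewrite inE.
by apply: contraT => /domD[y _]; rewrite (negPf (noedge _ _)).
Qed.

End Domination.

Lemma domination_number_compl_isolated (G : sgraph) (x : G) :
  (forall y, ~~ adj x y) -> domination_number (complement G) = 1%N.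
Proof.
move=> isox; apply/eqP; rewrite eqn_leq (@domination_number_gt0 (complement G) x).
rewrite andbT -(cards1 (x : complement G)); apply: domination_number_le.
apply/dominatingP => y; rewrite inE => yx; exists x; rewrite ?inE //.
by rewrite /= /compl_adj /= yx adj_sym isox.
Qed.

Definition clique_with_isolated (k m : nat) : sgraph :=
  disjoint_union (complete_graph k) (copies m (complete_graph 1)).

Lemma clique_with_isolated_iso (G : sgraph) (T : {set G}) :
  (forall x y, adj x y = [&& x != y, x \in T & y \in T]) ->
  graph_isomorphic G (clique_with_isolated #|T| #|~: T|).
Proof.
move=> adjT.
pose h (u : clique_with_isolated #|T| #|~: T|) : G :=
  match u with inl i => enum_val i | inr p => enum_val p.1 end.
have inT i : h (inl i) \in T by exact: enum_valP.
have outT p : h (inr p) \notin T by have := enum_valP p.1; rewrite inE.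
have h_inj : injective h.
  move=> [i|[j j']] [i'|[l l']] e.
  - by rewrite (enum_val_inj e).
  - by have := inT i; rewrite e (negPf (outT _)).
  - by have := inT i'; rewrite -e (negPf (outT _)).
  - by move: e => /enum_val_inj /= ->; rewrite !ord1.
have h_bij : bijective h.
  apply: (inj_card_bij h_inj).
  by rewrite card_sum card_prod !card_ord muln1 cardsC.
have [g hK gK] := h_bij; exists g; split; first by exists h.
move=> x y; rewrite -{2}[x]gK -{2}[y]gK adjT (inj_eq h_inj).
case: (g x) => [i|[j j']]; case: (g y) => [i'|[l l']].
- by rewrite !inT !andbT.
- by rewrite (negPf (outT _)) !andbF.
- by rewrite (negPf (outT _)) andbF.
- by rewrite (negPf (outT _)) andbF /= /copies_adj /complete_adj /= !ord1 /= andbF.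
Qed.

Lemma graph_isomorphic_dominating (G H : sgraph) (f : G -> H) (D : {set G}) :
  bijective f -> {mono f : x y / adj x y} -> dominating D -> dominating (f @: D).
Proof.
move=> [g fK gK] f_mono /dominatingP domD; apply/dominatingP => u uD.
have [|y yD xy] := domD (g u).
  by apply: contraNN uD => guD; rewrite -[u]gK imset_f.
by exists (f y); rewrite ?imset_f // -[u]gK f_mono.
Qed.

Lemma clique_with_isolated_dominating k m
    (D : {set clique_with_isolated k m}) :
  (0 < k)%N -> dominating D -> (m < #|D|)%N.
Proof.
case: k D => // k D _ /dominatingP domD.
have iso (p : 'I_m * 'I_1) : inr p \in D.
  apply: contraT => /domD[[//|[l l']] _].
  by rewrite /= /copies_adj /complete_adj /= !ord1 /= andbF.
have [i iD] : exists i, inl i \in D.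
  have [D0|/domD[[i|//] iD _]] := boolP (inl ord0 \in D); first by exists ord0.
  by exists i.
have -> : m.+1 = #|inl i |: [set inr p | p : ('I_m * 'I_1)]|.
  rewrite cardsU1 card_imset; last by move=> p q [].
  rewrite card_prod !card_ord muln1.
  by case: imsetP => // -[].
by apply/subset_leq_card/subsetP => u /setU1P[->//|/imsetP[p _ ->]].
Qed.

Lemma domination_number_clique_with_isolated (G : sgraph) k m :
  (0 < k)%N -> graph_isomorphic G (clique_with_isolated k m) ->
  (m < domination_number G)%N.
Proof.
move=> k0 [f [f_bij f_mono]]; have [D domD ->] := domination_number_ex G.
rewrite -(card_imset _ (bij_inj f_bij)).
apply: clique_with_isolated_dominating k0 _.
exact: graph_isomorphic_dominating.
Qed.

(** * Centralisers *)

Section Rng.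
Variable R : finRngType.
Implicit Types (x y z a b : R) (A D : {set R}).
Local Open Scope rng_scope.

Lemma rmul0l x : 0 * x = 0 :> R.
Proof. by apply: (addIr (0 * x)%rng); rewrite -rmulDl !add0r. Qed.

Lemma rmul0r x : x * 0 = 0 :> R.
Proof. by apply: (addIr (x * 0)%rng); rewrite -rmulDr !add0r. Qed.

Lemma rmulNl x y : (- x) * y = - (x * y)%rng :> R.
Proof. by apply: (addIr (x * y)%rng); rewrite -rmulDl !addNr rmul0l. Qed.

Lemma rmulNr x y : x * (- y) = - (x * y)%rng :> R.
Proof. by apply: (addIr (x * y)%rng); rewrite -rmulDr !addNr rmul0r. Qed.

Definition rcomm x y := x * y == y * x.

Lemma rcommC x y : rcomm x y = rcomm y x.
Proof. exact: eq_sym. Qed.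

Lemma rcomm_refl x : rcomm x x.
Proof. exact: eqxx. Qed.

Lemma rcomm0 x : rcomm x 0.
Proof. by rewrite /rcomm rmul0l rmul0r. Qed.

Lemma rcommD x y z : rcomm x y -> rcomm x z -> rcomm x (y + z).
Proof. by rewrite /rcomm rmulDl rmulDr => /eqP-> /eqP->. Qed.

Lemma rcommMn x y n : rcomm x y -> rcomm x (y *+ n).
Proof.
by move=> xy; elim: n => [|n IHn]; rewrite ?rcomm0 // mulrS rcommD.
Qed.

Definition centraliser A := [set z | [forall a in A, rcomm z a]].

Lemma centraliserP A z : reflect {in A, forall a, rcomm z a} (z \in centraliser A).
Proof. by rewrite inE; apply: forall_inP. Qed.

Lemma in_cent1 a z : (z \in centraliser [set a]) = rcomm z a.
Proof.
apply/centraliserP/idP => [-> //|za b]; first by rewrite inE.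
by rewrite inE => /eqP ->.
Qed.

Lemma centraliser_add_closed A : add_closed (centraliser A).
Proof.
split; first by apply/centraliserP => a _; rewrite rcommC rcomm0.
move=> x y /centraliserP xA /centraliserP yA; apply/centraliserP => a Aa.
by rewrite rcommC rcommD // rcommC ?xA ?yA.
Qed.

Lemma centraliserU A B : centraliser (A :|: B) = centraliser A :&: centraliser B.
Proof.
apply/setP => z; rewrite in_setI; apply/centraliserP/andP => [zAB|].
  by split; apply/centraliserP => a Aa; apply: zAB; rewrite inE Aa ?orbT.
by case=> /centraliserP zA /centraliserP zB a /setUP[/zA|/zB].
Qed.

(** For x <> 0 in a ring with trivial centre, these are the isolated vertices of
    the commuting graph; [isolated 0] only holds in the zero ring. *)
Definition isolated x := forall y, rcomm x y -> y = 0 \/ y = x.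

Lemma isolatedP x :
  reflect (isolated x) [forall y, rcomm x y ==> (y == 0) || (y == x)].
Proof.
apply: (iffP forallP) => isox y; last first.
  by apply/implyP => /isox[] ->; rewrite eqxx ?orbT.
by have /implyP h := isox y => /h/orP[]/eqP; [left|right].
Qed.

Lemma nisolated x : ~ isolated x -> exists y, [/\ rcomm x y, y != 0 & y != x].
Proof.
move/isolatedP; rewrite negb_forall => /existsP[y].
by rewrite negb_imply negb_or => /and3P[]; exists y.
Qed.

Lemma isolated_dec :
  (forall x, x != 0 -> isolated x) \/ exists2 x, x != 0 & ~ isolated x.
Proof.
case: (boolP [forall x, (x != 0) ==> [forall y, rcomm x y ==> (y == 0) || (y == x)]]).
  by move/forallP => iso; left=> x x0; apply/isolatedP/(implyP (iso x)).
rewrite negb_forall => /existsP[x]; rewrite negb_imply => /andP[x0 /isolatedP nx].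
by right; exists x.
Qed.

Lemma nisolated_dec :
  (forall x, x != 0 -> ~ isolated x) \/ exists2 x, x != 0 & isolated x.
Proof.
case: (boolP [exists x, (x != 0) && [forall y, rcomm x y ==> (y == 0) || (y == x)]]).
  by case/existsP => x /andP[x0 /isolatedP isox]; right; exists x.
rewrite negb_exists => /forallP iso; left=> x x0 /isolatedP isox.
by have := iso x; rewrite x0 isox.
Qed.

Lemma isolated_add_closed x : isolated x -> add_closed [set 0; x].
Proof.
move=> isox; suff -> : [set 0; x] = centraliser [set x] by exact: centraliser_add_closed.
apply/setP => y; rewrite in_cent1 !inE; apply/orP/idP => [[]/eqP ->|].
- by rewrite rcommC rcomm0.
- exact: rcomm_refl.
by rewrite rcommC => /isox[] ->; rewrite eqxx; [left|right].
Qed.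

Lemma isolated_addxx x : isolated x -> x + x = 0.
Proof.
move=> isox; have [->|x0] := eqVneq x 0; first exact: addr0.
have := add_closed_mulrn (isolated_add_closed isox) (setU11 _ _ : 0 \in _).
have := add_closed_mulrn (isolated_add_closed isox) (setU1r _ (set11 _) : x \in _).
by rewrite cards2 eq_sym x0 mulr2n.
Qed.

Lemma isolated_card_even x : isolated x -> x != 0 -> ~~ odd #|R|.
Proof.
move=> isox x0; rewrite -dvdn2 -cardsT.
have <- : #|[set 0; x]| = 2%N by rewrite cards2 eq_sym x0.
apply: add_closed_dvdn (isolated_add_closed isox) _ (subsetT _).
by split=> [|y z _ _]; rewrite in_setT.
Qed.

(** If k = |C(a)| is odd, then k a = 0 and 2 x = 0 give k (x + a) = x, so x
    commutes with x + a and x + a is 0 or x. *)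
Lemma isolated_centraliser_even x a :
  isolated x -> x != 0 -> a != 0 -> ~~ odd #|centraliser [set a]|.
Proof.
move=> isox x0 a0; apply/negP => odd_a.
have a_k : a *+ #|centraliser [set a]| = 0.
  by apply: add_closed_mulrn (centraliser_add_closed _) _; rewrite in_cent1 rcomm_refl.
have xa_k : (x + a) *+ #|centraliser [set a]| = x.
  rewrite mulrnDl a_k addr0 -[RHS]mulr1n -(odd_double_half #|_|) odd_a.
  by rewrite mulrnDr -muln2 mulnC mulrnA mulr2n isolated_addxx // mul0rn addr0.
have : rcomm x (x + a) by rewrite rcommC -{2}xa_k rcommMn ?rcomm_refl.
case/isox => /eqP; last by rewrite -subr_eq0 addrAC subrr add0r (negPf a0).
rewrite addr_eq0 => /eqP xa.
have ax : a = x.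
  by apply/eqP; rewrite -subr_eq0 xa opprK -[a]opprK -xa -opprD isolated_addxx // oppr0.
(* The case x + a = 0 leaves a = x, whose centraliser {0, x} has order 2. *)
suff c2 : centraliser [set a] = [set 0; a] by move: odd_a; rewrite c2 cards2 eq_sym a0.
apply/setP => z; rewrite in_cent1 !inE ax; apply/idP/orP.
  by rewrite rcommC => /isox[] ->; rewrite eqxx; [left|right].
by case=> /eqP ->; rewrite ?rcomm_refl // rcommC rcomm0.
Qed.

End Rng.

(** * The commuting graph of a ring with trivial centre *)

Section TrivialCenter.
Variable R : finRngType.
Hypothesis center0 : rng_center R = [set 0].
Implicit Types (x y z a b : R) (D : {set R}).

Local Notation Gamma := (commuting_graph R).
Local Notation gamma := (domination_number Gamma).
Local Notation gammac := (domination_number (complement Gamma)).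

Lemma noncentralE x : (x \notin rng_center R) = (x != 0).
Proof. by rewrite center0 inE. Qed.

Lemma vertex_neq0 (v : Gamma) : val v != 0.
Proof. by rewrite -noncentralE (valP v). Qed.

Lemma vertex_of x : x != 0 -> exists v : Gamma, val v = x.
Proof. by rewrite -noncentralE => xZ; exists (Sub x xZ). Qed.

Lemma commuting_adjE (v w : Gamma) : adj v w = (v != w) && rcomm (val v) (val w).
Proof. by []. Qed.

Lemma card_commuting_graph : #|Gamma|.+1 = #|R|.
Proof.
rewrite card_sig -(cardC (mem (rng_center R))) center0 cards1 add1n.
by congr _.+1; apply: eq_card => x; rewrite !inE center0 inE.
Qed.

Lemma noncommuting x : x != 0 -> exists y, ~~ rcomm x y.
Proof.
rewrite -noncentralE inE negb_forall => /existsP[y xy].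
by exists y.
Qed.

Lemma commuting_edgeless :
  (forall x, x != 0 -> isolated x) -> forall v w : Gamma, ~~ adj v w.
Proof.
move=> iso v w; rewrite commuting_adjE; apply/negP => /andP[vw].
case/(iso _ (vertex_neq0 v)) => [w0|/val_inj wv].
  by have := vertex_neq0 w; rewrite w0 eqxx.
by rewrite wv eqxx in vw.
Qed.

Lemma isolated_vertex x : x != 0 -> isolated x ->
  exists v : Gamma, forall w, ~~ adj v w.
Proof.
move=> x0 isox; have [v vx] := vertex_of x0; exists v => w.
rewrite commuting_adjE vx; apply/negP => /andP[vw /isox[w0|]].
  by have := vertex_neq0 w; rewrite w0 eqxx.
by rewrite -vx => /val_inj wv; rewrite wv eqxx in vw.
Qed.

(** The vertices outside S form a dominating set. The inequality is strict
    because 0 is not a vertex. *)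
Lemma commuting_graph_sub (S : {set R}) :
  (forall x, x \in S -> x != 0 /\
     exists y, [/\ y != 0, y \notin S & rcomm x y]) ->
  (gamma + #|S| < #|R|)%N.
Proof.
move=> outS; rewrite -card_commuting_graph ltnS.
have -> : #|S| = #|[set v : Gamma | val v \in S]|.
  rewrite -(card_imset _ (@val_inj _ _ (noncentral R))); apply: eq_card => x.
  apply/idP/imsetP => [Sx|[v]]; last by rewrite inE => ? ->.
  by have [/vertex_of[v vx] _] := outS x Sx; exists v; rewrite ?inE vx.
apply: domination_number_sub => v; rewrite inE => Sv.
have [_ [y [/vertex_of[w <-] Sw vw]]] := outS _ Sv.
exists w; rewrite ?inE // commuting_adjE vw andbT.
by apply: contraNneq Sw => <-.
Qed.

Lemma card_centraliserD a : a != 0 ->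
  #|centraliser [set a] :\: [set 0; a]| = (#|centraliser [set a]| - 2)%N.
Proof.
move=> a0; rewrite cardsDS ?cards2 1?eq_sym ?a0 //.
by apply/subsetP => x; rewrite in_cent1 !inE => /orP[]/eqP->; rewrite ?rcomm_refl // rcommC rcomm0.
Qed.

Lemma centraliser_bound a : a != 0 -> (gamma + #|centraliser [set a]| <= #|R|.+1)%N.
Proof.
move=> a0; suff : (gamma + #|centraliser [set a] :\: [set 0%R; a]| < #|R|)%N.
  by rewrite card_centraliserD //; lia.
apply: commuting_graph_sub => x; rewrite in_setD in_cent1 !inE negb_or.
case/andP=> /andP[x0 xa] cxa; split=> //; exists a.
by rewrite a0 in_setD !inE eqxx orbT.
Qed.

(** An element that commutes with all of D is central, so any other vertex is
    joined to D in the complement graph. *)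
Lemma centraliser_dominates D :
  centraliser D = [set 0] -> (gammac <= #|D|)%N.
Proof.
move=> cD; pose S := [set v : complement Gamma | val v \in D].
have /leq_trans -> // : (gammac <= #|S|)%N; last first.
  rewrite -(card_imset _ (@val_inj _ _ (noncentral R))); apply: subset_leq_card.
  by apply/subsetP => x /imsetP[v]; rewrite inE => ? ->.
apply: domination_number_le; apply/dominatingP => v vS.
have : val v \notin centraliser D by rewrite cD inE vertex_neq0.
rewrite inE negb_forall_in => /exists_inP[d Dd vd].
have /vertex_of[w wd] : d != 0 by apply: contraNneq vd => ->; rewrite rcomm0.
exists w; first by rewrite inE wd.
rewrite /= /compl_adj /= /comm_adj /=; apply/andP; split.
  by apply: contraNneq vS => ->; rewrite inE wd.
by rewrite negb_and wd -/(rcomm _ _) vd orbT.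
Qed.

(** Adjoining to D an element that does not commute with some z in C(D)
    replaces C(D) by a proper subgroup, hence at least halves it. *)
Lemma small_centralising_set :
  exists2 D : {set R}, centraliser D = [set 0] & (2 ^ #|D| <= #|R|)%N.
Proof.
pose P D := (2 ^ #|D| * #|centraliser D| <= #|R|)%N.
have P0 : P set0 by rewrite /P cards0 mul1n max_card.
case: (arg_maxnP (fun D => #|D|) P0) => D PD maxD; exists D; last first.
  apply: leq_trans PD; rewrite leq_pmulr // card_gt0.
  by apply/set0Pn; exists 0; exact: (proj1 (centraliser_add_closed D)).
apply/eqP; rewrite eqEsubset sub1set (proj1 (centraliser_add_closed D)) andbT.
apply/subsetP => z zD; rewrite inE; apply: contraT => z0.
have [d zd] := noncommuting z0.
have dD : d \notin D by apply: contraNN zd; move/centraliserP: zD; apply.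
suff /maxD : P (d |: D) by rewrite cardsU1 dD add1n /= ltnn.
apply: leq_trans PD; rewrite cardsU1 dD add1n expnSr -mulnA leq_mul2l orbC.
rewrite add_closed_proper //; try exact: centraliser_add_closed.
rewrite centraliserU properE subsetIr; apply/subsetPn; exists z => //.
by rewrite in_setI in_cent1 (negPf zd).
Qed.

Lemma card_centraliser_gt2 a : a != 0 -> ~ isolated a -> (2 < #|centraliser [set a]|)%N.
Proof.
move=> a0 /nisolated[b [ab b0 ba]].
have : (uniq [:: 0; a; b]) by rewrite /= !inE negb_or ![0 == _]eq_sym a0 b0 eq_sym ba.
move/card_uniqP => /= <-; apply/subset_leq_card/subsetP => x.
by rewrite in_cent1 !inE => /or3P[]/eqP->; rewrite ?rcomm_refl // rcommC ?rcomm0.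
Qed.

(** C(z) contains the five distinct elements 0, z, a, b and a + b. *)
Lemma big_centraliser z a b : z != 0 -> rcomm z a -> rcomm z b -> ~~ rcomm a b ->
  (4 < #|centraliser [set z]|)%N.
Proof.
move=> z0 za zb ab.
have a0 : a != 0 by apply: contraNneq ab => ->; rewrite rcommC rcomm0.
have b0 : b != 0 by apply: contraNneq ab => ->; rewrite rcomm0.
have nza : z != a by apply: contraNneq ab => <-.
have nzb : z != b by apply: contraNneq ab => <-; rewrite rcommC.
have nab : a != b by apply: contraNneq ab => <-; rewrite rcomm_refl.
have nabz : a + b != z.
  by apply: contraNneq ab => abz; rewrite -[b](addKr a) rcommD ?abz 1?rcommC //
    /rcomm rmulNl rmulNr.
have nab0 : a + b != 0.
  apply: contraNneq ab => /eqP; rewrite addrC addr_eq0 => /eqP ->.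
  by rewrite /rcomm rmulNl rmulNr.
have naba : a + b != a by rewrite -subr_eq0 addrAC subrr add0r.
have nabb : a + b != b by rewrite -subr_eq0 addrK.
have : uniq [:: 0; z; a; b; a + b].
  rewrite /= !inE !negb_or ![0 == _]eq_sym ![_ == a + b]eq_sym.
  by rewrite z0 a0 b0 nab0 nza nzb nab nabz naba nabb.
move/card_uniqP => /= <-; apply/subset_leq_card/subsetP => x; rewrite in_cent1 !inE rcommC.
case/or4P => [| | |/orP[]] /eqP ->; by rewrite ?rcomm0 ?rcomm_refl ?rcommD.
Qed.

(** If C(a) and C(b) meet trivially then 9 <= |C(a)| |C(b)| <= n and gammac <= 2.
    Otherwise they share some z <> 0, and 2 |C(z)| <= n with |C(z)| >= 5 leaves
    enough room for the logarithmic bound on gammac. *)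
Lemma no_isolated_bound a : a != 0 ->
  (forall x, x != 0 -> ~ isolated x) -> (gamma + gammac + 3 <= #|R|)%N.
Proof.
move=> a0 niso.
have gamma_half : (2 * gamma < #|R|)%N.
  rewrite -card_commuting_graph ltnS; apply: domination_number_half => v.
  have [y [vy /vertex_of[w wy] yv]] := nisolated (niso _ (vertex_neq0 v)).
  exists w; rewrite commuting_adjE wy vy andbT; apply: contraNneq yv => ->.
  by rewrite wy.
have [b ab] := noncommuting a0.
have b0 : b != 0 by apply: contraNneq ab => ->; rewrite rcomm0.
have ca := card_centraliser_gt2 a0 (niso _ a0).
have cb := card_centraliser_gt2 b0 (niso _ b0).
have [] := boolP (centraliser [set a; b] == [set 0]) => [/eqP cab|].
  have := centraliser_dominates cab; rewrite cards2 => gc2.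
  have := add_closed_trivI (centraliser_add_closed [set a]) (centraliser_add_closed [set b]).
  rewrite -centraliserU => /(_ cab) h.
  have h9 : (3 * 3 <= #|R|)%N by apply: leq_trans h; apply: leq_mul.
  have g2 : (gammac <= 2)%N by apply: leq_trans gc2 _; case: (a != b).
  lia.
have cab := centraliser_add_closed [set a; b].
rewrite eqEsubset sub1set (proj1 cab) andbT => /subsetPn[z zab]; rewrite inE => z0.
have R10 : (10 <= #|R|)%N.
  have [c zc] := noncommuting z0.
  have z5 : (4 < #|centraliser [set z]|)%N.
    by apply: big_centraliser ab => //; apply: (centraliserP _ _ zab);
      rewrite !inE eqxx ?orbT.
  suff : (2 * #|centraliser [set z]| <= #|R|)%N by lia.
  rewrite -cardsT; apply: add_closed_proper (centraliser_add_closed _) _ _.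
    by split=> [|x y _ _]; rewrite inE.
  rewrite properT; apply: contraNneq zc => cT.
  by rewrite rcommC -in_cent1 cT in_setT.
have [D cD D2] := small_centralising_set.
have gcD := centraliser_dominates cD.
(* 2 k + 5 <= 2^k holds from k = 4 on; for k <= 3 the bound n >= 10 suffices,
   since 2 gamma < n gives gamma <= 4 when n = 10. *)
have : (gammac <= 3 \/ 2 * gammac + 5 <= #|R|)%N.
  have [|D4] := leqP #|D| 3; first by lia.
  suff : (2 * #|D| + 5 <= 2 ^ #|D|)%N by lia.
  elim: #|D| D4 => // k IHk; rewrite ltnS leq_eqVlt expnS => /orP[/eqP<-//|/IHk].
  lia.
by lia.
Qed.

Lemma isolated_edge_bound (c a : R) :
    c != 0 -> isolated c -> a != 0 -> ~ isolated a ->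
  (gamma + gammac + 2 <= #|R|)%N.
Proof.
move=> c0 isoc a0 nisoa.
have [v isov] := isolated_vertex c0 isoc.
rewrite (domination_number_compl_isolated isov).
have := card_centraliser_gt2 a0 nisoa; have := isolated_centraliser_even isoc c0 a0.
have := centraliser_bound a0; case: #|centraliser _| => [|[|[|[|k]]]] //; lia.
Qed.

(** ** Equality: a single triangle *)

Section Extremal.
Variable c : R.
Hypotheses (c0 : c != 0) (isoc : isolated c).
Hypothesis (extremal : (#|R| <= gamma + gammac + 2)%N).

Lemma extremal_gamma : (#|R| <= gamma + 3)%N.
Proof.
have [v isov] := isolated_vertex c0 isoc; move: extremal.
by rewrite (domination_number_compl_isolated isov) -addnA.
Qed.

Lemma extremal_card a : a != 0 -> ~ isolated a -> #|centraliser [set a]| = 4%N.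
Proof.
move=> a0 nisoa; have := card_centraliser_gt2 a0 nisoa.
have := isolated_centraliser_even isoc c0 a0; have := centraliser_bound a0.
have := extremal_gamma; case: #|centraliser _| => [|[|[|[|[|k]]]]] //; lia.
Qed.

(** The intersection of C(a) and C(b) contains 0, a, b and its order divides
    |C(a)| = 4, so it is all of C(a), and likewise all of C(b). *)
Lemma extremal_centraliser a b : a != 0 -> b != 0 -> a != b -> rcomm a b ->
  centraliser [set a] = centraliser [set b].
Proof.
move=> a0 b0 ab cab.
have nisoa : ~ isolated a.
  by move=> /(_ _ cab)[/eqP|/esym/eqP]; rewrite ?(negPf b0) ?(negPf ab).
have nisob : ~ isolated b.
  by move=> /(_ a)[|/eqP|/eqP]; rewrite 1?rcommC // ?(negPf a0) ?(negPf ab).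
have ca := extremal_card a0 nisoa; have cb := extremal_card b0 nisob.
have [clA clB] := (centraliser_add_closed [set a], centraliser_add_closed [set b]).
have dvd4 := add_closed_dvdn (add_closedI clA clB) clA (subsetIl _ _).
have gt2 : (2 < #|centraliser [set a] :&: centraliser [set b]|)%N.
  have : uniq [:: 0; a; b] by rewrite /= !inE negb_or ![0 == _]eq_sym a0 b0 ab.
  move/card_uniqP => /= <-; apply/subset_leq_card/subsetP => x.
  rewrite !(in_cons, in_nil) orbF => /or3P[]/eqP->; rewrite in_setI.
  - by rewrite (proj1 clA) (proj1 clB).
  - by rewrite !in_cent1 rcomm_refl.
  - by rewrite !in_cent1 rcomm_refl rcommC cab.
have eq4 : #|centraliser [set a] :&: centraliser [set b]| = 4%N.
  move: gt2 dvd4 (subset_leq_card (subsetIl (centraliser [set a]) (centraliser [set b]))).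
  by rewrite ca; case: #|_| => [|[|[|[|[|k]]]]].
have /setIidPl sAB : centraliser [set a] :&: centraliser [set b] = centraliser [set a].
  by apply/eqP; rewrite eqEcard subsetIl ca eq4.
by apply/eqP; rewrite eqEcard sAB ca cb.
Qed.

Lemma extremal_clique a b : a != 0 -> rcomm a b -> b != 0 -> b != a ->
  graph_isomorphic Gamma (clique_with_isolated 3 (#|R| - 4)).
Proof.
move=> a0 cab b0 ba.
have nisoa : ~ isolated a by move=> /(_ _ cab)[/eqP|/eqP]; rewrite ?(negPf b0) ?(negPf ba).
have ca := extremal_card a0 nisoa.
have inA x y : x \in centraliser [set a] -> y \in centraliser [set a] -> rcomm x y.
  have [->|x0] := eqVneq x 0; first by rewrite rcommC rcomm0.
  have [->|xa] := eqVneq x a; first by rewrite [rcomm a y]rcommC !in_cent1.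
  rewrite in_cent1 => xa'; rewrite (extremal_centraliser a0 x0) 1?eq_sym 1?rcommC //.
  by rewrite in_cent1 rcommC.
(* An edge x y outside C(a) would allow x to be left out of the dominating set
   together with the two elements of C(a) other than 0 and a. *)
have edgeA x y : x != 0 -> y != 0 -> x != y -> rcomm x y -> x \in centraliser [set a].
  move=> x0 y0 xy cxy; apply: contraT => xA.
  have yA : y \notin centraliser [set a].
    apply: contraNN xA => yA; have [ya|ya] := eqVneq y a; first by rewrite -ya in_cent1.
    rewrite (extremal_centraliser a0 y0) 1?eq_sym //; first by rewrite in_cent1.
    by rewrite rcommC -in_cent1.
  pose S := x |: (centraliser [set a] :\: [set 0; a]).
  have cS : #|S| = 3%N by rewrite cardsU1 card_centraliserD // ca in_setD (negPf xA) andbF.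
  have : (gamma + #|S| < #|R|)%N; last by rewrite cS ltnNge extremal_gamma.
  apply: commuting_graph_sub => z /setU1P[->|].
    split=> //; exists y; split=> //.
    by rewrite in_setU1 in_setD (negPf yA) andbF orbF eq_sym.
  rewrite in_setD in_cent1 in_set2 negb_or => /andP[/andP[z0 za] cza]; split=> //.
  exists a; split=> //.
  rewrite in_setU1 in_setD in_set2 eqxx orbT orbF /=.
  by apply: contraNneq xA => <-; rewrite in_cent1 rcomm_refl.
pose T := [set v : Gamma | val v \in centraliser [set a]].
have inT v : (v \in T) = (val v \in centraliser [set a]) by rewrite in_set.
have cT : #|T| = 3%N.
  have -> : #|T| = #|centraliser [set a] :\ 0|.
    rewrite -(card_imset _ (@val_inj _ _ (noncentral R))); apply: eq_card => x.
    apply/imsetP/idP => [[v]|].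
      by rewrite inT => vA ->; rewrite in_setD1 vertex_neq0.
    by rewrite in_setD1 => /andP[/vertex_of[v <-] vA]; exists v; first by rewrite inT.
  have := cardsD1 0 (centraliser [set a]); rewrite ca (proj1 (centraliser_add_closed _)).
  by rewrite add1n => -[<-].
have <- : #|~: T| = (#|R| - 4)%N.
  by have := cardsC T; rewrite cT -card_commuting_graph; lia.
rewrite -cT; apply: clique_with_isolated_iso => v w.
rewrite commuting_adjE !inT; have [//|/= vw] := eqVneq v w.
apply/idP/andP => [cvw|[]]; last exact: inA.
have vw' : val v != val w by apply: contraNneq vw => /val_inj ->.
split; first by apply: edgeA cvw; rewrite ?vertex_neq0.
by rewrite rcommC in cvw; apply: edgeA cvw; rewrite ?vertex_neq0 // eq_sym.
Qed.

End Extremal.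

End TrivialCenter.

(** * Rings whose commuting graph has no edges *)

Section Edgeless.
Variable R : finRngType.
Hypothesis center0 : rng_center R = [set 0].
Hypothesis iso : forall x : R, x != 0 -> isolated x.
Implicit Types x y z : R.
Local Open Scope rng_scope.

Lemma edgeless_addxx x : x + x = 0.
Proof. by have [->|/iso/isolated_addxx] := eqVneq x 0; rewrite ?addr0. Qed.

Lemma edgeless_addr_eq0 x y : x + y = 0 -> x = y.
Proof. by move=> xy0; apply: (addIr y); rewrite xy0 edgeless_addxx. Qed.

Lemma rmul_sqr x : x != 0 -> x * x = 0 \/ x * x = x.
Proof. by move/iso; apply; rewrite /rcomm rmulA. Qed.

Lemma edgeless_nilpotent : (exists x y : R, x * y <> y * x) -> exists2 x : R, x != 0 & x * x = 0.
Proof.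
case=> a [b ab].
suff /existsP[x /andP[x0 /eqP xx]] : [exists x : R, (x != 0) && (x * x == 0)] by exists x.
apply: contraT; rewrite negb_exists => /forallP nonil; case: ab.
have idem x : x * x = x.
  have [->|x0] := eqVneq x 0; first exact: rmul0l.
  by have := nonil x; rewrite x0; case: (rmul_sqr x0) => [->|//]; rewrite eqxx.
(* Expand a + b = (a + b)^2. *)
apply: edgeless_addr_eq0; apply: (addrI a); apply: (addIr b).
by rewrite addr0 -[RHS]idem rmulDl !rmulDr !idem !addrA.
Qed.

(** x y x commutes with x, so it is 0 or x. In the second case e = x y is an
    idempotent with y x e = 0, so w = y x + e y x satisfies e w = w e = 0; hence
    w is 0 or e, that is w = 0, and then x = x (y x) = x e y x = x^2 y y x = 0. *)
Lemma edgeless_sandwich x y : x != 0 -> x * x = 0 -> x * y * x = 0.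
Proof.
move=> x0 xx.
have [//|xyx] : x * y * x = 0 \/ x * y * x = x.
  by apply: (iso x0); rewrite /rcomm -[in X in _ == X]rmulA xx rmul0r !rmulA xx !rmul0l.
pose e := x * y; pose f := y * x; pose w := f + (e * f)%rng.
have ee : e * e = e by rewrite /e rmulA xyx.
have e0 : e != 0 by apply: contraNneq x0 => e0; rewrite -xyx -/e e0 rmul0l.
have fe : f * e = 0 by rewrite /f /e rmulA -(rmulA y) xx rmul0r rmul0l.
have ew : e * w = 0 by rewrite rmulDr rmulA ee edgeless_addxx.
have we : w * e = 0 by rewrite rmulDl -rmulA fe rmul0r addr0.
have [|/edgeless_addr_eq0 fef|we'] := iso e0 (y := w).
- by rewrite /rcomm ew we.
- have xf : x * f = x by rewrite /f rmulA.
  by rewrite xyx -xf fef /e !rmulA xx !rmul0l.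
by case/eqP: e0; rewrite -ee -{2}we'.
Qed.

(** Once x^2 = 0 and x y x = 0, the products x y and y x commute with x, so they
    lie in {0, x}; they differ unless y is 0 or x, so two such y have the same
    commutator with x and their sum is again 0 or x. *)
Lemma edgeless_structure : (exists x y : R, x * y <> y * x) ->
  exists x y : R, [/\ x != 0, y != 0 & y != x] /\
    [/\ x * x = 0, y * y = y, x * y = x /\ y * x = 0 \/ x * y = 0 /\ y * x = x
      & forall z, [\/ z = 0, z = x, z = y | z = x + y]].
Proof.
case/edgeless_nilpotent=> x x0 xx.
have xz z : x * z = 0 \/ x * z = x.
  by apply: (iso x0); rewrite /rcomm rmulA xx rmul0l edgeless_sandwich.
have zx z : z * x = 0 \/ z * x = x.
  by apply: (iso x0); rewrite /rcomm -(rmulA z) xx rmul0r rmulA edgeless_sandwich.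
have nxz z : ~~ rcomm x z -> x * z = x /\ z * x = 0 \/ x * z = 0 /\ z * x = x.
  rewrite /rcomm; case: (xz z) (zx z) => [->|->] [->|->]; rewrite ?eqxx //; by [left|right].
have [y xy] := noncommuting center0 x0.
have y0 : y != 0 by apply: contraNneq xy => ->; exact: rcomm0.
exists x, y; split.
  by split=> //; apply: contraNneq xy => ->; exact: rcomm_refl.
split=> //; first 1 last.
- exact: nxz.
- move=> z; have [|xz'] := boolP (rcomm x z).
    by case/(iso x0) => ->; [constructor 1 | constructor 2].
  have : rcomm x (z + y).
    rewrite /rcomm rmulDl rmulDr.
    by case: (nxz _ xy) (nxz _ xz') => [[-> ->]|[-> ->]] [[-> ->]|[-> ->]];
      rewrite ?addr0 ?add0r ?edgeless_addxx.
  case/(iso x0) => [/edgeless_addr_eq0 ->|zyx]; first by constructor 3.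
  by constructor 4; rewrite -zyx -addrA edgeless_addxx addr0.
have [yy|//] := rmul_sqr y0; case/eqP: x0.
case: (nxz _ xy) => [[xyx _]|[_ yxx]].
  by rewrite -xyx -xyx -rmulA yy rmul0r.
by rewrite -yxx -yxx rmulA yy rmul0l.
Qed.

End Edgeless.

(** * The rings E and F *)

Section Table.
Variable R : finRngType.
Variables p q : R.
Hypotheses (p2 : p + p = 0) (q2 : q + q = 0).
Implicit Types u v : 'rV['F_2]_2.

(** The additive map from the free F_2-module on two generators that sends the
    generators to p and q. *)
Definition comb u : R := p *+ u 0 0 + q *+ u 0 1.

Lemma mulrn_F2D (r : R) (s t : 'F_2) : r + r = 0 -> r *+ (s + t)%R = r *+ s + r *+ t.
Proof.
move=> r2; case: s => [[|[|//]] ?]; case: t => [[|[|//]] ?];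
  by rewrite /= ?addr0 ?add0r ?r2.
Qed.

Lemma comb_add : {morph comb : u v / u + v}.
Proof.
by move=> u v; rewrite /comb !mxE !mulrn_F2D // addrACA.
Qed.

Lemma comb_scale (s : 'F_2) u : comb (s *: u) = comb u *+ s.
Proof.
rewrite /comb !mxE; case: s => [[|[|//]] i].
  have -> : Ordinal i = 0 by exact: val_inj.
  by rewrite !mul0r addr0.
have -> : Ordinal i = 1 by exact: val_inj.
by rewrite !mul1r.
Qed.

Lemma rmul_mulrn (r r' : R) m n : ((r *+ m) * (r' *+ n))%rng = (r * r')%rng *+ (m * n).
Proof.
have L k : (r * (r' *+ k))%rng = (r * r')%rng *+ k.
  by elim: k => [|k IHk]; rewrite ?rmul0r // !mulrS rmulDr IHk.
elim: m => [|m IHm]; first by rewrite rmul0l.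
by rewrite mulrS rmulDl IHm L mulSn mulrnDr.
Qed.

Lemma comb_mul xx xy yx yy :
    [/\ (p * p)%rng = comb xx, (p * q)%rng = comb xy,
        (q * p)%rng = comb yx & (q * q)%rng = comb yy] ->
  {morph comb : u v / table_mul xx xy yx yy u v >-> (u * v)%rng}.
Proof.
case=> pp pq qp qq u v; rewrite /table_mul !comb_add !comb_scale -pp -pq -qp -qq.
rewrite /comb !(rmulDl, rmulDr) !rmul_mulrn !addrA.
have F2M (s t : 'F_2) (r : R) : r *+ (s * t)%R = r *+ (s * t)%N.
  by case: s => [[|[|//]] ?]; case: t => [[|[|//]] ?].
by rewrite !F2M -!addrA.
Qed.

Lemma comb_bij : p != 0 -> q != 0 -> p != q ->
  (forall z, [\/ z = 0, z = p, z = q | z = p + q]) -> bijective comb.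
Proof.
move=> p0 q0 pq all4.
have pq0 : p + q != 0.
  by apply: contraNneq pq => /eqP; rewrite addr_eq0 => /eqP ->; rewrite eq_sym -addr_eq0 q2.
have row u : u = \row_j (if j == 0 then u 0 0 else u 0 1).
  apply/rowP => j; rewrite mxE; case: j => [[|[|//]] ?] /=.
    by congr (u _ _); apply: val_inj.
  by congr (u _ _); apply: val_inj.
have ker u : comb u = 0 -> u = 0.
  rewrite [u]row; case: (u 0 0) (u 0 1) => [[|[|//]] i] [[|[|//]] j]; rewrite /comb !mxE /=.
  - by move=> _; apply/rowP => k; rewrite !mxE; case: ifP => _; apply: val_inj.
  - by move/eqP; rewrite add0r (negPf q0).
  - by move/eqP; rewrite addr0 (negPf p0).
  - by move/eqP; rewrite (negPf pq0).
have comb_inj : injective comb.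
  move=> u v uv; apply/eqP; rewrite -subr_eq0; apply/eqP/ker.
  suff: comb (u - v) + comb v = comb v by rewrite -{2}[comb v]add0r => /addIr.
  by rewrite -comb_add subrK.
apply: (inj_card_bij comb_inj).
apply: leq_trans (leq_image_card comb predT); apply: subset_leq_card.
apply/subsetP => z _.
pose r (s t : 'F_2) : 'rV['F_2]_2 := \row_j (if j == 0 then s else t).
have combr s t : comb (r s t) = p *+ s + q *+ t by rewrite /comb !mxE.
apply/codomP; case: (all4 z) => ->;
  [exists (r 0 0) | exists (r 1 0) | exists (r 0 1) | exists (r 1 1)];
  by rewrite combr /= ?addr0 ?add0r.
Qed.

End Table.

Lemma rng_isomorphic_can (R S : finRngType) (g : S -> R) :
  bijective g -> {morph g : x y / x + y} -> {morph g : x y / (x * y)%rng} ->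
  rng_isomorphic R S.
Proof.
move=> [f gK fK] gD gM; exists f; split; first by exists g.
  by move=> x y; apply: (can_inj gK); rewrite gD !fK.
by move=> x y; apply: (can_inj gK); rewrite gM !fK.
Qed.

Lemma isolated_isomorphic (R S : finRngType) : rng_isomorphic R S ->
  (forall u : S, u != 0 -> isolated u) -> forall x : R, x != 0 -> isolated x.
Proof.
case=> f [f_bij fD fM] isoS x x0 y xy.
have f0 : f 0 = 0 by apply: (addIr (f 0)); rewrite -fD !add0r.
have f_inj := bij_inj f_bij.
have fx0 : f x != 0 by rewrite -f0 (inj_eq f_inj).
case: (isoS _ fx0 (f y)); first by rewrite /rcomm -!fM (eqP xy).
  by rewrite -f0 => /f_inj; left.
by move/f_inj; right.
Qed.

Lemma row2P (u v : 'rV['F_2]_2) : u 0 0 = v 0 0 -> u 0 1 = v 0 1 -> u = v.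
Proof.
move=> e0 e1; apply/rowP => j; case: j => [[|[|//]] i].
  by rewrite (_ : Ordinal i = 0) //; apply: val_inj.
by rewrite (_ : Ordinal i = 1) //; apply: val_inj.
Qed.

(** For (a, b) and (c, d) in F_2^2, equality of (c + d) (a, b) and
    (a + b) (c, d) says that they commute in E; the product of F is the opposite
    one. *)
Lemma F2_parallel (a b c d : 'F_2) : a * (c + d) = c * (a + b) -> b * (c + d) = d * (a + b) ->
  [\/ a = 0 /\ b = 0, c = 0 /\ d = 0 | c = a /\ d = b].
Proof.
have F2 (s : 'F_2) : s = 0 \/ s = 1.
  by case: s => [[|[|//]] i]; [left|right]; apply: val_inj.
case: (F2 a) (F2 b) (F2 c) (F2 d) => -> [] -> [] -> [] -> // _ _;
  by [constructor 1 | constructor 2 | constructor 3].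
Qed.

Lemma ringE_isolated (u : ringE) : u != 0 -> isolated u.
Proof.
move=> u0 v /eqP; rewrite [LHS]/(mulE u v) [RHS]/(mulE v u) => /rowP e.
have := e 1; have := e 0; rewrite /table_mul !mxE /= !mulr0 !mulr1 !addr0 !add0r -!mulrDr.
move=> e0 e1; case: (F2_parallel e0 e1) => -[h0 h1].
- by case/eqP: u0; apply: row2P; rewrite mxE.
- by left; apply: row2P; rewrite mxE.
- by right; apply: row2P.
Qed.

Lemma ringF_isolated (u : ringF) : u != 0 -> isolated u.
Proof.
move=> u0 v /eqP; rewrite [LHS]/(mulF u v) [RHS]/(mulF v u) => /rowP e.
have := e 1; have := e 0; rewrite /table_mul !mxE /= !mulr0 !mulr1 !addr0 !add0r -!mulrDl.
rewrite ![_ * v _ _]mulrC ![_ * u _ _]mulrC => /esym e0 /esym e1.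
case: (F2_parallel e0 e1) => -[h0 h1].
- by case/eqP: u0; apply: row2P; rewrite mxE.
- by left; apply: row2P; rewrite mxE.
- by right; apply: row2P.
Qed.

Lemma isolated_isomorphic_EF (R : finRngType) : rng_center R = [set 0] ->
  (exists x y : R, (x * y)%rng <> (y * x)%rng) ->
  (forall x : R, x != 0 -> isolated x) ->
  rng_isomorphic R ringE \/ rng_isomorphic R ringF.
Proof.
move=> center0 noncomm iso.
have [x [y [[x0 y0 yx] [xx yy xy all4]]]] := edgeless_structure center0 iso noncomm.
have two := edgeless_addxx iso.
(* In E and F the nilpotent element is the sum of the generators. *)
pose g := comb y (x + y).
have gx : g genx = y by rewrite /g /comb !mxE /= mulr1n mulr0n addr0.
have gy : g geny = x + y by rewrite /g /comb !mxE /= mulr1n mulr0n add0r.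
have g_bij : bijective g.
  apply: comb_bij => //.
  - by apply: contraNneq yx => /(edgeless_addr_eq0 iso) ->.
  - by apply: contraNneq x0 => e; apply/eqP/(addIr y); rewrite add0r -e.
  - move=> z; case: (all4 z) => ->;
      [by constructor 1 | constructor 4 | by constructor 2 | by constructor 3].
    by rewrite addrCA two addr0.
have g_add : {morph g : u v / u + v} by apply: comb_add.
case: xy => [[xy' yx']|[xy' yx']].
  left; apply: (@rng_isomorphic_can R ringE g) => //.
  apply: comb_mul => //; rewrite -/g ?gx ?gy; split;
    by rewrite ?(rmulDl, rmulDr) ?xx ?yy ?xy' ?yx' ?add0r ?addr0 ?addrA ?two ?add0r.
right; apply: (@rng_isomorphic_can R ringF g) => //.
apply: comb_mul => //; rewrite -/g ?gx ?gy; split;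
  by rewrite ?(rmulDl, rmulDr) ?xx ?yy ?xy' ?yx' ?add0r ?addr0 ?addrA ?two ?add0r.
Qed.

Local Close Scope ring_scope.

Theorem theoremA (R : finRngType) (n : nat)
    (order_R : #|R| = n)
    (noncomm_R : exists x y : R, (x * y)%rng <> (y * x)%rng)
    (center_R : rng_center R = [set 0%R]) :
  [/\ (domination_number (commuting_graph R)
         + domination_number (complement (commuting_graph R)) = n
       <-> rng_isomorphic R ringE \/ rng_isomorphic R ringF),
      domination_number (commuting_graph R)
        + domination_number (complement (commuting_graph R)) <> n - 1 &
      (domination_number (commuting_graph R)
         + domination_number (complement (commuting_graph R)) = n - 2
       <-> ~~ odd n /\
           graph_isomorphic (commuting_graph R)
             (disjoint_union (complete_graph 3) (copies (n - 4) (complete_graph 1))))].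
Proof.
subst n; case: (noncomm_R) => a [b ab].
have a0 : a != 0%R by apply: contra_notN ab => /eqP ->; rewrite rmul0l rmul0r.
have R2 : 2 <= #|R|.
  by rewrite -cardsT (cardsD1 0%R) (cardsD1 a) !inE a0.
set g := domination_number _; set gc := domination_number _.
have [v va] := vertex_of center_R a0.
have [iso|[x x0 nisox]] := isolated_dec R.
  have noedge := commuting_edgeless center_R iso.
  have sum_n : g + gc = #|R|.
    rewrite /g /gc (domination_number_compl_isolated (noedge v)).
    by rewrite (domination_number_edgeless noedge) addn1 card_commuting_graph.
  rewrite sum_n; split; [split=> // _ | lia | split; first lia].
    exact: isolated_isomorphic_EF.
  case=> _ [f [[f' fK f'K] f_mono]].
  pose vertex3 i : clique_with_isolated 3 (#|R| - 4) := inl i.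
  have := noedge (f' (vertex3 ord0)) (f' (vertex3 ord_max)).
  by rewrite -f_mono !f'K.
have [y [xy y0 yx]] := nisolated nisox.
have noEF : ~ (rng_isomorphic R ringE \/ rng_isomorphic R ringF).
  case=> /isolated_isomorphic iso; apply: nisox; apply: iso x0;
    [exact: ringE_isolated | exact: ringF_isolated].
have [sum_le eq_iso] : g + gc + 2 <= #|R| /\
    (g + gc + 2 = #|R| -> ~~ odd #|R| /\
       graph_isomorphic (commuting_graph R) (clique_with_isolated 3 (#|R| - 4))).
  have [niso|[c c0 isoc]] := nisolated_dec R.
    have : g + gc + 3 <= #|R|; last by lia.
    exact: (no_isolated_bound center_R a0).
  split; first exact: isolated_edge_bound c0 isoc x0 nisox.
  move=> e; split; first exact: isolated_card_even isoc c0.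
  by apply: (extremal_clique center_R c0 isoc _ x0 xy y0 yx); rewrite e.
split; [split=> [|/noEF //]; lia | lia |].
split=> [e|[_ /domination_number_clique_with_isolated gamma_lb]].
  by apply: eq_iso; lia.
have := gamma_lb isT.
have := @domination_number_gt0 (complement (commuting_graph R)) v.
by rewrite -/g -/gc; lia.
Qed.
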